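(* Let $P\in\mathcal S(\pi)$, let $G$ be a finite group acting on $\mathcal X$, and assume that $\pi$ is $G$-invariant. For any $1\le p\le\infty$ and $\varepsilon>0$, $$t_{\mathrm{mix},p}((P_{la})_{ra},2\varepsilon)\le t_{\mathrm{mix},p}(P_{la},\varepsilon)\le t_{\mathrm{mix},p}\Big((P_{la})_{ra},\frac\varepsilon2\Big)+1,$$ $$t_{\mathrm{mix},p}((P_{la})_{ra},2\varepsilon)\le t_{\mathrm{mix},p}(P_{ra},\varepsilon)\le t_{\mathrm{mix},p}\Big((P_{la})_{ra},\frac\varepsilon2\Big)+1.$$
   Context: $\mathcal X$ is a Polish space with its $\sigma$-algebra $\mathcal F$, $\pi$ a probability measure on it; $\mathcal S(\pi)$ is the set of Markov kernels $P$ with $\pi P=\pi$. $G$ acts measurably; $\pi$ is $G$-invariant if $\pi(gA)=\pi(A)$ for all $g\in G,A\in\mathcal F$. Standing assumption: $\pi$ has a density with respect to a reference measure $\mathfrak m$ on $\mathcal X$, and $\mathfrak m$ is invariant under every $g\in G$. $\mu$ is the uniform distribution on $G$, $U_g[f](x)=f(gx)$, $P_{la}=\mathbb E_{g\sim\mu}(U_gP)$, $P_{ra}=\mathbb E_{g\sim\mu}(PU_g)$, $(P_{la})_{ra}=\mathbb E_{(g,h)\sim\mu\otimes\mu}(U_gPU_h)$, where $P[f](x)=\int f(y)P(x,dy)$. For $1\le p\le\infty$, $\|\cdot\|_{p,\pi}$ is the $L^p(\pi)$ norm. For a $\pi$-stationary kernel $P$ and $t\in\mathbb N=\{1,2,\dots\}$,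 $d_p(P,t)=\pi\text{-}\mathrm{ess\,sup}_{x\in\mathcal X}\big\|\frac{dP^t(x,\cdot)}{d\pi}-1\big\|_{p,\pi}$; if $P^t(x,\cdot)$ is not absolutely continuous with respect to $\pi$, set $d_1(P,t)=2$ and $d_p(P,t)=\infty$ for $p>1$, and the corresponding mixing times are set to be $\infty$. The mixing time is $t_{\mathrm{mix},p}(P,\varepsilon)=\inf\{t\in\mathbb N:d_p(P,t)\le\varepsilon\}$ (with $\inf\emptyset=\infty$). *)

(* Defs.v *)
From HB Require Import structures.
From mathcomp Require Import all_boot all_order all_algebra all_fingroup.
From mathcomp Require Import all_classical all_reals all_analysis.
From mathcomp Require Import measurable_realfun ess_sup_inf.

Set Implicit Arguments.
Unset Strict Implicit.
Unset Printing Implicit Defensive.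

Import Order.TTheory GRing.Theory Num.Theory.
Import numFieldNormedType.Exports.

Local Open Scope classical_set_scope.
Local Open Scope ring_scope.
Local Open Scope ereal_scope.
Local Open Scope charge_scope.

(* Separable and homeomorphic to a complete metric space. *)
Definition polish_space (R : realType) (X : topologicalType) : Prop :=
  (exists2 D : set X, countable D & dense D) /\
  exists (M : metricType R) (f : X -> M) (g : M -> X),
    [/\ cancel f g, cancel g f, continuous f, continuous g &
      forall F : set_system M, ProperFilter F -> cauchy F ->
        exists l : M, F --> l].

Notation borel X := (g_sigma_algebraType (@open X)).

(* A left action. As the group is finite, measurability of the action map
   G * T -> T amounts to measurability of each translation. *)
Record measurable_action d (gT : finGroupType) (T : measurableType d) := {
  act :> gT -> T -> T ;
  act1x : forall x, act 1%g x = x ;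
  actMx : forall g h x, act (g * h)%g x = act g (act h x) ;
  measurable_act : forall g, measurable_fun [set: T] (act g) }.

Section kernels.
Context {d : measure_display} {T : measurableType d} {R : realType}.

(* (P Q)(x, A) = \int P(x, dy) Q(y, A), i.e. (P Q)[f] = P[Q[f]] *)
Definition kmul (P Q : R.-pker T ~> T) : T -> {measure set T -> \bar R} :=
  mkcomp_noparam P Q.

Section kmul_instance.
Variables P Q : R.-pker T ~> T.

Let measurable_kmul U :
  measurable U -> measurable_fun [set: T] (kmul P Q ^~ U).
Proof. exact: (measurable_kernel (mkcomp_noparam P Q)). Qed.

HB.instance Definition _ := isKernel.Build _ _ _ _ R (kmul P Q) measurable_kmul.

Let kmul_prob x : kmul P Q x [set: T] = 1.
Proof.
rewrite /kmul /mkcomp_noparam /= /kcomp_noparam.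
under eq_integral do rewrite prob_kernel.
by rewrite integral_cst// mul1e prob_kernel.
Qed.

HB.instance Definition _ := Kernel_isProbability.Build _ _ _ _ R
  (kmul P Q) kmul_prob.
End kmul_instance.

Fixpoint kpow (P : R.-pker T ~> T) (t : nat) : R.-pker T ~> T :=
  if t is t'.+1 then kmul P (kpow P t')
  else kdirac (@measurable_id _ T setT).

Section kavg.
Variables (gT : finGroupType) (K : gT -> R.-pker T ~> T).

Definition kavg_fun (x : T) (A : set T) : \bar R :=
  (#|gT|%:R^-1)%:E * \sum_(g : gT) K g x A.

Let kavg0 x : kavg_fun x set0 = 0.
Proof. by rewrite /kavg_fun big1 ?mule0// => g _; rewrite measure0. Qed.

Let kavg_ge0 x A : 0 <= kavg_fun x A.
Proof.
by rewrite mule_ge0 ?lee_fin ?invr_ge0 ?ler0n// sume_ge0.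
Qed.

Let kavg_sigma_additive x : semi_sigma_additive (kavg_fun x).
Proof.
move=> F mF tF mUF.
rewrite (_ : (fun n => _) = (fun n => (#|gT|%:R^-1)%:E *
    \sum_(g : gT) \sum_(0 <= i < n) K g x (F i))); last first.
  apply/funext => n; rewrite /kavg_fun exchange_big/= ge0_sume_distrr//.
  by move=> i _; exact: sume_ge0.
apply: cvgeZl => //.
rewrite /kavg_fun; apply: cvg_nnesum => [g _|g _].
  by near=> n; exact: sume_ge0.
exact: measure_semi_sigma_additive.
Unshelve. all: by end_near. Qed.

HB.instance Definition _ x := isMeasure.Build d T R (kavg_fun x)
  (kavg0 x) (kavg_ge0 x) (@kavg_sigma_additive x).

(* Expectation of [K g] for [g] uniformly distributed on the group. *)
Definition kavg : T -> {measure set T -> \bar R} := kavg_fun.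

Let measurable_kavg U : measurable U -> measurable_fun [set: T] (kavg ^~ U).
Proof.
move=> mU; rewrite /kavg /= /kavg_fun.
apply: measurable_funeM; apply: emeasurable_sum => g.
exact: measurable_kernel.
Qed.

HB.instance Definition _ := isKernel.Build _ _ _ _ R kavg measurable_kavg.

Let kavg_prob x : kavg x [set: T] = 1.
Proof.
rewrite /kavg /= /kavg_fun.
under eq_bigr do rewrite prob_kernel.
rewrite sumEFin -EFinM sumr_const mulVf// pnatr_eq0 -lt0n.
by apply/card_gt0P; exists 1%g.
Qed.

HB.instance Definition _ := Kernel_isProbability.Build _ _ _ _ R kavg kavg_prob.
End kavg.

Section group_averages.
Variables (gT : finGroupType) (a : measurable_action gT T).

(* U_g[f](x) = f(g x), i.e. U_g(x, .) is the Dirac mass at g x *)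
Definition U_ (g : gT) : R.-pker T ~> T := kdirac (measurable_act a g).

Definition P_la (P : R.-pker T ~> T) : R.-pker T ~> T :=
  kavg (fun g : gT => kmul (U_ g) P).

Definition P_ra (P : R.-pker T ~> T) : R.-pker T ~> T :=
  kavg (fun g : gT => kmul P (U_ g)).

Definition group_invariant (m : set T -> \bar R) : Prop :=
  forall (g : gT) (A : set T), measurable A -> m (a g @` A) = m A.
End group_averages.

Section law.
Variables (P : R.-pker T ~> T) (x : T).

(* [P x] as an object of type [probability T R]. *)
Definition klaw : set T -> \bar R := P x.

HB.instance Definition _ := Measure.on klaw.

Let klaw_setT : klaw [set: T] = 1. Proof. exact: prob_kernel. Qed.

HB.instance Definition _ := Measure_isProbability.Build _ _ _ klaw klaw_setT.
End law.

Section mixing.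
Variable pi : probability T R.

Definition stationary (P : R.-pker T ~> T) : Prop :=
  forall A, measurable A -> \int[pi]_x P x A = pi A.

Definition has_density (m : {measure set T -> \bar R}) : Prop :=
  exists f : T -> R, [/\ measurable_fun [set: T] f, (forall x, (0 <= f x)%R) &
    forall A, measurable A -> pi A = \int[m]_(x in A) (f x)%:E].

Definition step_ac (P : R.-pker T ~> T) (t : nat) : Prop :=
  {ae pi, forall x, kpow P t x `<< pi}.

Definition step_density (P : R.-pker T ~> T) (t : nat) (x : T) : T -> \bar R :=
  'd (charge_of_finite_measure (klaw (kpow P t) x)) '/d pi.

Definition mix_dist (p : \bar R) (P : R.-pker T ~> T) (t : nat) : \bar R :=
  if `[< step_ac P t >] then
    ess_sup pi (fun x => 'N[pi]_p[(fun y => step_density P t x y - 1)])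
  else if p == 1 then 2%:E else +oo.

(* The conjunct [step_ac P t] matters only for p = 1 and eps >= 2: it expresses
   that times without absolute continuity do not count, even though the
   conventional value 2 of the distance would then be below eps. *)
Definition t_mix (p : \bar R) (P : R.-pker T ~> T) (eps : R) : \bar R :=
  ereal_inf [set (t%:R)%:E | t in
    [set t : nat | [/\ (0 < t)%N, step_ac P t & mix_dist p P t <= eps%:E]]].
End mixing.
End kernels.

(* Main.v *)
Require Import Defs.
From HB Require Import structures.
From mathcomp Require Import all_boot all_order all_algebra all_fingroup.
From mathcomp Require Import all_classical all_reals all_analysis.
From mathcomp Require Import measurable_realfun ess_sup_inf ring lra.
From Stdlib Require Setoid Morphisms.

Import Order.TTheory GRing.Theory Num.Theory.
Import numFieldNormedType.Exports.
Local Open Scope classical_set_scope.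
Local Open Scope ring_scope.
Local Open Scope ereal_scope.
Local Open Scope charge_scope.

(** Let [Q] be the kernel moving a point uniformly over its orbit. Then
    [P_la P = Q P], [P_ra P = P Q] and [(P_la P)_ra = Q P Q] ([keq_P_la],
    [keq_P_ra]), while [Q] is idempotent and leaves [pi] stationary
    ([orbit_kernel_idem], [orbit_kernel_stationary]). Writing [L = Q P],
    [S = P Q] and [W = Q P Q], regrouping the factors of a power gives

      [W^t = L^t Q], [W^t = Q S^t], [L^(t+1) = W^t L], [S^(t+1) = P W^t]

    for [t >= 1]. So each of the four comparisons says that multiplying a
    kernel by a stationary kernel, on the right or on the left, does not
    increase the essential supremum of [||dK(x,.)/dpi - 1||_p]
    ([mixed_kmulr], [mixed_kmull]). Monotonicity in [eps] accounts for
    the factors 2 and 1/2.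

    Both contraction properties follow from one dual description of the norm.
    The bound [||rho - 1||_p <= c] can be written [\int Phi (rho - 1) <= C]
    with [Phi] convex: [Phi u = |u|^p] and [C = c^p] for finite [p], and
    [Phi u = max(0, |u| - c)] and [C = 0] for [p] infinite ([Lnorm_gauge]).
    If [theta] is a slope of [Phi], the tangent inequality
    [Phi u >= Phi w + theta w (u - w)] bounds the integral of [theta w]
    against [rho pi] by [C] plus an integral against [pi], for every test
    function [w], with equality of the pointwise terms at [w = rho - 1].
    Hence the bound on the norm amounts to a family of inequalities that are
    affine in the measure ([dual_bound]).
    - Affine inequalities pass to mixtures, which settles multiplication on
      the left ([dual_bound_mixture]).
    - For multiplication on the right by [J], the tangent inequality is
      integrated at [u = rho y - 1] and [w z], over [pi(dy) J(y, dz)], both of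
      whose marginals are [pi] by stationarity ([dual_bound_density]).
    - The norm is recovered by testing with truncations of [rho - 1]
      ([density_bound]). *)

(** * Integration against mixtures, and equality of kernels *)

Section mixtures.
Set Implicit Arguments.
Unset Strict Implicit.
Context {d : measure_display} {T : measurableType d} {R : realType}.
Implicit Types (K L M N : R.-pker T ~> T) (mu pi : probability T R).

Lemma measurable_integral_kernel K (f : T -> \bar R) :
  (forall y, 0 <= f y) -> measurable_fun [set: T] f ->
  measurable_fun [set: T] (fun x => \int[K x]_y f y).
Proof.
by move=> f0 mf; apply: measurable_fun_integral_kernel => // U;
   exact: measurable_kernel.
Qed.

(** Obtained from the integration formula for parameterized kernels, by viewing
    [mu] as a constant kernel and letting [K] ignore the parameter. *)
Lemma integral_mixture mu K (nu : {measure set T -> \bar R})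
    (f : T -> \bar R) :
  (forall A, measurable A -> nu A = \int[mu]_y K y A) ->
  (forall y, 0 <= f y) -> measurable_fun [set: T] f ->
  \int[nu]_z f z = \int[mu]_y \int[K y]_z f z.
Proof.
move=> nuE f0 mf.
pose l := kprobability (measurable_cst (mu : pprobability T R)) : T -> _.
rewrite -(@integral_kcomp _ _ _ T T T R l (kernel.kernel_snd K) point f f0 mf).
by apply: eq_measure_integral => A mA _; rewrite nuE.
Qed.

Lemma integral_kmul K L (f : T -> \bar R) x :
  (forall y, 0 <= f y) -> measurable_fun [set: T] f ->
  \int[kmul K L x]_z f z = \int[K x]_y \int[L y]_z f z.
Proof.
move=> f0 mf; by rewrite (@integral_mixture (klaw K x) L).
Qed.

Lemma integral_stationary pi K (f : T -> \bar R) :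
  stationary pi K -> (forall y, 0 <= f y) -> measurable_fun [set: T] f ->
  \int[pi]_y \int[K y]_z f z = \int[pi]_z f z.
Proof.
move=> Kpi f0 mf; rewrite [RHS](@integral_mixture pi K)// => A mA.
by rewrite Kpi.
Qed.

Lemma integral_cst_prob mu (c : \bar R) : \int[mu]_x c = c.
Proof. by rewrite integral_cst//= probability_setT mule1. Qed.

Lemma integral_cst_pker K x (c : \bar R) : \int[K x]_y c = c.
Proof. by rewrite integral_cst//= prob_kernel mule1. Qed.

Lemma stationary_kmul pi K L :
  stationary pi K -> stationary pi L -> stationary pi (kmul K L).
Proof.
move=> Kpi Lpi A mA; rewrite -(Lpi _ mA).
by rewrite -[RHS](integral_stationary Kpi)//; exact: measurable_kernel.
Qed.

Lemma ae_stationary_null pi K A : stationary pi K ->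
  measurable A -> pi A = 0 -> {ae pi, forall x, K x A = 0}.
Proof.
move=> Kpi mA A0; have : ae_eq pi setT (fun x => K x A) (cst 0).
  apply/ae_eq_integral_abs => //; first exact: measurable_kernel.
  by under eq_integral do rewrite gee0_abs//; rewrite Kpi.
by apply: filterS => x; exact.
Qed.

(** Stationarity makes [pi]-null sets null for almost all the laws [K x]: this
    is how an almost sure property survives a step of the chain. *)
Lemma ae_stationary pi K (S : T -> Prop) : stationary pi K ->
  {ae pi, forall x, S x} -> {ae pi, forall x, {ae K x, forall y, S y}}.
Proof.
move=> Kpi [N [mN N0 SN]]; have := ae_stationary_null Kpi mN N0.
by apply: filterS => x KN; exists N.
Qed.

(** Composition is defined by integrals, so associativity and the unit laws
    hold on measurable sets only; identities between kernels are therefore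
    stated up to this relation. *)
Definition keq K L := forall x A, measurable A -> K x A = L x A.

Lemma keq_sym K L : keq K L -> keq L K.
Proof. by move=> KL x A mA; rewrite KL. Qed.

Lemma keq_trans L K M : keq K L -> keq L M -> keq K M.
Proof. by move=> KL LM x A mA; rewrite KL// LM. Qed.

Lemma keq_kmul K K' L L' : keq K K' -> keq L L' -> keq (kmul K L) (kmul K' L').
Proof.
move=> KK' LL' x A mA; rewrite /kmul/= /mkcomp_noparam/= /kcomp_noparam.
under eq_integral do rewrite LL'//.
by apply: eq_measure_integral => B mB _; exact: KK'.
Qed.

Lemma kmulA K L M : keq (kmul K (kmul L M)) (kmul (kmul K L) M).
Proof.
move=> x A mA; rewrite [RHS](integral_kmul K L)//.
exact: measurable_kernel.
Qed.

(** [kpow M 0] is the identity kernel whatever [M] is. *)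
Lemma kmul1 K : keq (kmul K (kpow K 0)) K.
Proof.
move=> x A mA; rewrite /kmul/= /mkcomp_noparam/= /kcomp_noparam.
by rewrite /= integral_indic// setIT.
Qed.

Lemma kmul1l K M : keq (kmul (kpow M 0) K) K.
Proof.
move=> x A mA; rewrite /kmul/= /mkcomp_noparam/= /kcomp_noparam.
rewrite /kdirac integral_dirac//= ?diracT ?mul1e//.
exact: measurable_kernel.
Qed.

Lemma stationary1 pi K : stationary pi (kpow K 0).
Proof. by move=> A mA; rewrite /= integral_indic// setIT. Qed.
End mixtures.

(** * Powers of kernels factored through an idempotent *)

Section powers.
Set Implicit Arguments.
Unset Strict Implicit.
Context {d : measure_display} {T : measurableType d} {R : realType}.
Implicit Types (K L P Q S W : R.-pker T ~> T).

(** The product bundled as a probability kernel, so that it can be declared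
    compatible with [keq] and rewritten under. *)
Definition pkmul K L : R.-pker T ~> T := kmul K L.

#[local] Instance keq_equivalence : RelationClasses.Equivalence (@keq d T R).
Proof.
by split=> [K x A mA|K L|K L M]//; [exact: keq_sym|exact: keq_trans].
Qed.

#[local] Instance pkmul_proper :
  Morphisms.Proper (Morphisms.respectful (@keq d T R)
    (Morphisms.respectful (@keq d T R) (@keq d T R))) pkmul.
Proof. by move=> K K' KK' L L' LL'; exact: keq_kmul. Qed.

Let pkmulA K L M : keq (pkmul K (pkmul L M)) (pkmul (pkmul K L) M).
Proof. exact: kmulA. Qed.

Let pkmul1 K M : keq (pkmul K (kpow M 0)) K. Proof. exact: kmul1. Qed.
Let pkmul1l K M : keq (pkmul (kpow M 0) K) K. Proof. exact: kmul1l. Qed.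
Let kpowS K n : keq (kpow K n.+1) (pkmul K (kpow K n)). Proof. by []. Qed.
(* Rewriting modulo [keq] must not unfold powers and products. *)
Opaque kpow pkmul.

Lemma kpow_kmulr Q L W n : keq W (pkmul L Q) -> keq (pkmul Q L) L ->
  keq (kpow W n.+1) (pkmul (kpow L n.+1) Q).
Proof.
move=> WE QL; elim: n => [|n IH]; first by rewrite !kpowS !pkmul1.
rewrite kpowS IH WE !kpowS -[X in keq X _]pkmulA.
by rewrite [pkmul Q _]pkmulA [pkmul Q _]pkmulA QL pkmulA.
Qed.

Lemma kpow_kmull Q S W n : keq W (pkmul Q S) -> keq (pkmul S Q) S ->
  keq (kpow W n.+1) (pkmul Q (kpow S n.+1)).
Proof.
move=> WE SQ; elim: n => [|n IH]; first by rewrite !kpowS !pkmul1.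
by rewrite kpowS IH WE -pkmulA [pkmul S _]pkmulA SQ kpowS.
Qed.

Lemma kpowS_kmulr Q L W n : keq W (pkmul L Q) -> keq (pkmul Q L) L ->
  keq (kpow L n.+1) (pkmul (kpow W n) L).
Proof.
move=> WE QL; elim: n => [|n IH]; first by rewrite kpowS pkmul1 pkmul1l.
have QLn : keq (pkmul Q (kpow L n.+1)) (kpow L n.+1) by rewrite kpowS pkmulA QL.
by rewrite kpowS -QLn pkmulA -WE IH pkmulA -kpowS.
Qed.

Lemma kpowS_kmull P Q S W n : keq W (pkmul Q S) -> keq S (pkmul P Q) ->
  keq (pkmul S Q) S -> keq (kpow S n.+2) (pkmul P (kpow W n.+1)).
Proof. by move=> WE SE SQ; rewrite (kpow_kmull n WE SQ) kpowS {1}SE pkmulA. Qed.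
End powers.

(** * Averaging over the orbits of the group *)

Section group_averaging.
Set Implicit Arguments.
Unset Strict Implicit.
Context {d : measure_display} {T : measurableType d} {R : realType}.
Context {gT : finGroupType} (a : measurable_action gT T).
Implicit Types (P : R.-pker T ~> T) (pi : probability T R).

Lemma integral_kavg (K : gT -> R.-pker T ~> T) x (f : T -> \bar R) :
  (forall y, 0 <= f y) -> measurable_fun [set: T] f ->
  \int[kavg K x]_y f y = (#|gT|%:R^-1)%:E * \sum_(g : gT) \int[K g x]_y f y.
Proof.
move=> f0 mf.
have c0 : (0 <= #|gT|%:R^-1 :> R)%R by rewrite invr_ge0.
pose m_ (i : nat) := K (nth 1%g (enum gT) i) x : {measure set T -> \bar R}.
have sumE (F : gT -> \bar R) :
    \sum_(g : gT) F g = \sum_(i < size (enum gT)) F (nth 1%g (enum gT) i).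
  by rewrite -big_enum/= (big_nth 1%g) big_mkord.
rewrite sumE -(ge0_integral_measure_sum m_)//.
rewrite -[#|gT|%:R^-1%R]/((NngNum c0)%:num) -ge0_integral_mscale//.
by apply: eq_measure_integral => A mA _; rewrite /= /kavg_fun sumE.
Qed.

Let avg_cst (y : \bar R) : y \is a fin_num ->
  (#|gT|%:R^-1)%:E * \sum_(g : gT) y = y.
Proof.
move=> /EFin_fin_numP[r ->].
rewrite sumEFin -EFinM sumr_const -[(r *+ _)%R]mulr_natl mulrA mulVf ?mul1r//.
by rewrite pnatr_eq0 -lt0n; apply/card_gt0P; exists 1%g.
Qed.

(** The kernel [E_g U_g], which resamples a point uniformly in its orbit. *)
Definition orbit_kernel : R.-pker T ~> T := kavg (fun g : gT => U_ a g).
Let Q := orbit_kernel.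

Let integral_U g x (f : T -> \bar R) : measurable_fun [set: T] f ->
  \int[U_ a g x]_y f y = f (a g x).
Proof. by move=> mf; rewrite /U_ /= integral_dirac//= ?diracT ?mul1e. Qed.

Let kmul_orbitE P x A : measurable A ->
  kmul Q P x A = (#|gT|%:R^-1)%:E * \sum_(g : gT) P (a g x) A.
Proof.
move=> mA; rewrite [LHS]integral_kavg//; last exact: measurable_kernel.
congr (_ * _); apply: eq_bigr => g _.
by rewrite integral_U//; exact: measurable_kernel.
Qed.

Lemma keq_P_la P : keq (P_la a P) (pkmul Q P).
Proof.
move=> x A mA; rewrite [RHS]kmul_orbitE//= /kavg_fun.
congr (_ * _); apply: eq_bigr => g _.
by rewrite [LHS]integral_U//; exact: measurable_kernel.
Qed.

Lemma keq_P_ra P : keq (P_ra a P) (pkmul P Q).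
Proof.
move=> x A mA; rewrite /= /kavg_fun /mkcomp_noparam/= /kcomp_noparam.
under [RHS]eq_integral do rewrite /= /kavg_fun.
rewrite ge0_integralZl//; last 2 first.
- by apply: emeasurable_sum => g; exact: (measurable_kernel (U_ a g)).
- by move=> y _; exact: sume_ge0.
rewrite ge0_integral_sum// => g.
exact: (measurable_kernel (U_ a g)).
Qed.

(** Right translation permutes the group, so the uniform law on the orbit of
    [g x] is the one on the orbit of [x]. *)
Lemma orbit_kernel_idem : keq (pkmul Q Q) Q.
Proof.
move=> x A mA; rewrite [LHS]kmul_orbitE//.
have QE g : Q (a g x) A = Q x A.
  rewrite /= /kavg_fun; congr (_ * _).
  rewrite [RHS](reindex_inj (mulIg g))/=.
  by apply: eq_bigr => h _; rewrite /kdirac actMx.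
under eq_bigr do rewrite QE.
by rewrite avg_cst// (fin_num_measure (klaw Q x)).
Qed.

Lemma orbit_kernel_stationary pi : group_invariant a pi -> stationary pi Q.
Proof.
move=> pi_inv A mA; rewrite /= /kavg_fun ge0_integralZl//; last 2 first.
- by apply: emeasurable_sum => g; exact: (measurable_kernel (U_ a g)).
- by move=> y _; exact: sume_ge0.
rewrite ge0_integral_sum//; last first.
  by move=> g; exact: (measurable_kernel (U_ a g)).
have UE g : \int[pi]_x kdirac (measurable_act a g) x A = pi A.
  have -> : \int[pi]_x kdirac (measurable_act a g) x A =
      pi (a g @^-1` A).
    rewrite -[a g @^-1` A]setIT -integral_indic//.
    by rewrite -[X in measurable X]setTI; exact: measurable_act.
  rewrite -[RHS](pi_inv g^-1%g)//; congr (pi _); apply/seteqP; split=> x /=.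
  - by move=> Ax; exists (a g x) => //; rewrite -actMx mulVg act1x.
  - by move=> [y Ay <-]; rewrite -actMx mulgV act1x.
under eq_bigr do rewrite UE.
by rewrite avg_cst// fin_num_measure.
Qed.
End group_averaging.

(** * Convex divergences from the stationary law and their duality *)

Section divergence.
Set Implicit Arguments.
Unset Strict Implicit.
Context {d : measure_display} {T : measurableType d} {R : realType}.
Variables (pi : probability T R) (Phi theta : R -> R) (C : R).

(** [theta] is a selection of subgradients of the convex function [Phi].
    Boundedness of the slopes on bounded sets makes truncations admissible
    test functions. *)
Record convex_gauge : Prop := {
  gauge_measurable : measurable_fun [set: R] Phi ;
  slope_measurable : measurable_fun [set: R] theta ;
  gauge_ge0 : forall u, (0 <= Phi u)%R ;
  gauge0 : Phi 0%R = 0%R ;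
  slope0 : theta 0%R = 0%R ;
  gauge_tangent : forall u w, (Phi w + theta w * (u - w) <= Phi u)%R ;
  slope_bounded : forall n, exists B, forall w,
    (`|w| <= n -> `|theta w| <= B)%R }.

Hypotheses (cPhi : convex_gauge) (C_ge0 : (0 <= C)%R).

(** Formally
    [\int (theta o w) d(nu - pi) <= C + \int (w * theta o w - Phi o w) dpi].
    Adding [\int theta o w dpi] and the constant [B], which has the same
    integral against both probabilities, makes the two integrands nonnegative:
    no integrability question arises. *)
Definition dual_bound (nu : {measure set T -> \bar R}) : Prop :=
  forall (w : T -> R) (B : R), measurable_fun [set: T] w ->
  (forall x, `|theta (w x)| <= B)%R ->
  \int[nu]_y (theta (w y) + B)%:E <=
  C%:E + \int[pi]_y (theta (w y) * (w y + 1) - Phi (w y) + B)%:E.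

Definition is_density (nu : set T -> \bar R) (rho : T -> R) :=
  forall f : T -> \bar R, (forall x, 0 <= f x) -> measurable_fun [set: T] f ->
  \int[nu]_x f x = \int[pi]_x (f x * (rho x)%:E).

Section test_functions.
Variables (w : T -> R) (B : R).
Hypotheses (mw : measurable_fun [set: T] w)
  (wB : forall x, (`|theta (w x)| <= B)%R).

Lemma test_bound_ge0 : (0 <= B)%R.
Proof. by rewrite (le_trans _ (wB point)). Qed.

Lemma test_ge0 y : (0 <= theta (w y) + B)%R.
Proof.
by have := wB y; rewrite ler_norml => /andP[]; rewrite -subr_ge0 opprK.
Qed.

Lemma penalty_ge0 y : (0 <= theta (w y) * (w y + 1) - Phi (w y) + B)%R.
Proof.
have := gauge_tangent cPhi 0%R (w y); rewrite (gauge0 cPhi).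
by have := test_ge0 y; nra.
Qed.

Lemma measurable_test : measurable_fun [set: T] (fun y => (theta (w y) + B)%:E).
Proof.
apply/measurable_EFinP; apply: measurable_funD => //.
exact: measurableT_comp (slope_measurable cPhi) mw.
Qed.

Lemma measurable_penalty : measurable_fun [set: T]
  (fun y => (theta (w y) * (w y + 1) - Phi (w y) + B)%:E).
Proof.
apply/measurable_EFinP; apply: measurable_funD => //.
apply: measurable_funB; last exact: measurableT_comp (gauge_measurable cPhi) mw.
apply: measurable_funM; last exact: measurable_funD.
exact: measurableT_comp (slope_measurable cPhi) mw.
Qed.
End test_functions.

(** The bound is affine in the measure, and its right-hand side does not
    depend on it, so it can be averaged. *)
Lemma dual_bound_mixture (mu : probability T R) (K : R.-pker T ~> T)
    (nu : {measure set T -> \bar R}) :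
  (forall A, measurable A -> nu A = \int[mu]_y K y A) ->
  {ae mu, forall y, dual_bound (K y)} -> dual_bound nu.
Proof.
move=> nuE Kdual w B mw wB.
have t0 y : 0 <= (theta (w y) + B)%:E by rewrite lee_fin test_ge0.
have p0 : 0 <= \int[pi]_y (theta (w y) * (w y + 1) - Phi (w y) + B)%:E.
  by apply: integral_ge0 => y _; rewrite lee_fin penalty_ge0.
rewrite (integral_mixture nuE)//; last exact: measurable_test.
rewrite -[leRHS](integral_cst_prob mu); apply: ae_ge0_le_integral => //.
- by move=> y _; exact: integral_ge0.
- by apply: measurable_integral_kernel => //; exact: measurable_test.
- by move=> y _; rewrite adde_ge0.
- by apply: filterS Kdual => y Ky _; exact: Ky.
Qed.

Lemma integral_density (nu : probability T R) rho :
  is_density nu rho -> \int[pi]_x (rho x)%:E = 1.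
Proof.
move=> nurho; rewrite -[RHS](integral_cst_prob nu) nurho//.
by apply: eq_integral => x _; rewrite mul1e.
Qed.

(** Data processing inequality. The tangent inequality is used at
    [u = rho y - 1] and [w z] and integrated over [pi(dy) K(y, dz)]: the terms
    depending on [z] alone integrate against [pi] because [K] is stationary,
    those depending on [y] alone give the divergence of [mu]. *)
Lemma dual_bound_density (mu : probability T R) (K : R.-pker T ~> T)
    (nu : {measure set T -> \bar R}) (rho : T -> R) :
  (forall A, measurable A -> nu A = \int[mu]_y K y A) ->
  stationary pi K -> measurable_fun [set: T] rho ->
  (forall x, 0 <= rho x)%R -> is_density mu rho ->
  \int[pi]_y (Phi (rho y - 1))%:E <= C%:E -> dual_bound nu.
Proof.
move=> nuE Kpi mrho rho0 murho PhiC w B mw wB.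
have t0 y : 0 <= (theta (w y) + B)%:E by rewrite lee_fin test_ge0.
have p0 y : 0 <= (theta (w y) * (w y + 1) - Phi (w y) + B)%:E.
  by rewrite lee_fin penalty_ge0.
have mt := measurable_test B mw; have mp := measurable_penalty B mw.
have B0 := test_bound_ge0 wB.
have mPhi : measurable_fun [set: T] (fun y => (Phi (rho y - 1))%:E).
  apply/measurable_EFinP; apply: measurableT_comp (gauge_measurable cPhi) _.
  exact: measurable_funB.
have Phi0 y : 0 <= (Phi (rho y - 1))%:E by rewrite lee_fin (gauge_ge0 cPhi).
have mrhoE : measurable_fun [set: T] (EFin \o rho) by exact/measurable_EFinP.
rewrite (integral_mixture nuE)// murho//; last 2 first.
- by move=> y; exact: integral_ge0.
- exact: measurable_integral_kernel.
(* [B] is added on the left and [B * rho y], of the same integral, on the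
   right, to compensate the shift of the test function. *)
have key y : (\int[K y]_z (theta (w z) + B)%:E) * (rho y)%:E + B%:E <=
    (Phi (rho y - 1))%:E + B%:E * (rho y)%:E +
    \int[K y]_z (theta (w z) * (w z + 1) - Phi (w z) + B)%:E.
  rewrite -ge0_integralZr ?lee_fin//.
  rewrite -[in leLHS](integral_cst_pker K y B%:E).
  rewrite -ge0_integralD//; last 2 first.
  + by move=> z _; rewrite mule_ge0// lee_fin.
  + by apply: emeasurable_funM.
  rewrite -[X in _ <= X + _](integral_cst_pker K y).
  rewrite -ge0_integralD//; last first.
    by move=> z _; rewrite adde_ge0// mule_ge0// lee_fin.
  apply: ge0_le_integral => //.
  + by move=> z _; rewrite adde_ge0 ?mule_ge0// lee_fin.
  + apply: emeasurable_funD => //; exact: emeasurable_funM.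
  + exact: emeasurable_funD.
  + move=> z _; rewrite -!EFinM -!EFinD lee_fin.
    by have := gauge_tangent cPhi (rho y - 1)%R (w z); nra.
rewrite -(@leeD2rE _ B%:E)//.
rewrite -[X in _ + X <= _](integral_cst_prob pi).
rewrite -ge0_integralD//; last 2 first.
- by move=> y _; rewrite mule_ge0 ?integral_ge0 ?lee_fin.
- by apply: emeasurable_funM => //; exact: measurable_integral_kernel.
have mKp : measurable_fun [set: T]
    (fun y => \int[K y]_z (theta (w z) * (w z + 1) - Phi (w z) + B)%:E).
  exact: measurable_integral_kernel.
have mBrho : measurable_fun [set: T] (fun y => B%:E * (rho y)%:E).
  exact: emeasurable_funM.
apply: (@le_trans _ _ (\int[pi]_y ((Phi (rho y - 1))%:E + B%:E * (rho y)%:E +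
    \int[K y]_z (theta (w z) * (w z + 1) - Phi (w z) + B)%:E))).
  apply: ge0_le_integral => //.
  - by move=> y _; rewrite adde_ge0 ?mule_ge0 ?integral_ge0 ?lee_fin.
  - apply: emeasurable_funD => //; apply: emeasurable_funM => //.
    exact: measurable_integral_kernel.
  - by apply: emeasurable_funD => //; exact: emeasurable_funD.
rewrite ge0_integralD//; last 3 first.
- by move=> y _; rewrite adde_ge0// mule_ge0// lee_fin.
- exact: emeasurable_funD.
- by move=> y _; exact: integral_ge0.
rewrite ge0_integralD//; last first.
  by move=> y _; rewrite mule_ge0// lee_fin.
rewrite (integral_stationary Kpi)// ge0_integralZl ?lee_fin//; last first.
  by move=> y _; rewrite lee_fin.
by rewrite (integral_density murho) mule1 addeAC leeD2r// leeD2r.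
Qed.

(** At [w = rho - 1] the tangent inequality is an equality, so the dual bound
    returns the divergence itself. As [w] has to be bounded, it is truncated,
    and monotone convergence removes the truncation. *)
Lemma density_bound (nu : probability T R) (rho : T -> R) :
  measurable_fun [set: T] rho -> (forall x, 0 <= rho x)%R ->
  is_density nu rho -> dual_bound nu ->
  \int[pi]_y (Phi (rho y - 1))%:E <= C%:E.
Proof.
move=> mrho rho0 nurho nudual.
have mrhoE : measurable_fun [set: T] (EFin \o rho) by exact/measurable_EFinP.
pose w (n : nat) y := if (`|rho y - 1| <= n%:R)%R then (rho y - 1)%R else 0%R.
have mw n : measurable_fun [set: T] (w n).
  apply: measurable_fun_ifT => //; last exact: measurable_funB.
  apply: measurable_fun_ler => //.
  by apply: measurableT_comp => //; exact: measurable_funB.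
have wn n y : (`|w n y| <= n%:R)%R.
  by rewrite /w; case: ifPn => // _; rewrite normr0.
have mPhiw n : measurable_fun [set: T] (fun y => (Phi (w n y))%:E).
  apply/measurable_EFinP; exact: measurableT_comp (gauge_measurable cPhi) _.
have PhiwC n : \int[pi]_y (Phi (w n y))%:E <= C%:E.
  have [B thetaB] := slope_bounded cPhi n%:R%R.
  have wB y : (`|theta (w n y)| <= B)%R by exact: thetaB.
  have t0 y : 0 <= (theta (w n y) + B)%:E by rewrite lee_fin test_ge0.
  have p0 y : 0 <= (theta (w n y) * (w n y + 1) - Phi (w n y) + B)%:E.
    by rewrite lee_fin penalty_ge0.
  have mt := measurable_test B (mw n); have mp := measurable_penalty B (mw n).
  have B0 := test_bound_ge0 wB.
  have mBrho : measurable_fun [set: T] (fun y => B%:E * (rho y)%:E).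
    exact: emeasurable_funM.
  (* [theta (w n) * (rho - 1) = theta (w n) * w n], also where [w n] has been
     cut to 0, because [theta 0 = 0]. *)
  have : \int[pi]_y ((theta (w n y) + B)%:E * (rho y)%:E) + B%:E =
      \int[pi]_y (Phi (w n y))%:E + B%:E +
      \int[pi]_y (theta (w n y) * (w n y + 1) - Phi (w n y) + B)%:E.
    rewrite -[X in _ + X = _](integral_cst_prob pi).
    rewrite -ge0_integralD//; last 2 first.
    - by move=> y _; rewrite mule_ge0// lee_fin.
    - exact: emeasurable_funM.
    have BE : B%:E = \int[pi]_y (B%:E * (rho y)%:E).
      rewrite ge0_integralZl ?lee_fin//; last by move=> y _; rewrite lee_fin.
      by rewrite (integral_density nurho) mule1.
    rewrite [X in _ = _ + X + _]BE -ge0_integralD//; last 2 first.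
    - by move=> y _; rewrite lee_fin (gauge_ge0 cPhi).
    - by move=> y _; rewrite mule_ge0// lee_fin.
    rewrite -ge0_integralD//; last 2 first.
    - by move=> y _; rewrite adde_ge0 ?mule_ge0 ?lee_fin ?(gauge_ge0 cPhi).
    - exact: emeasurable_funD.
    apply: eq_integral => y _; rewrite -!EFinM -!EFinD; congr (_%:E).
    rewrite /w; case: ifPn => _; first by ring.
    by rewrite (gauge0 cPhi) (slope0 cPhi); ring.
  have := nudual (w n) B (mw n) wB; rewrite nurho//.
  set I := \int[pi]_y (theta _ * _ - _ + _)%:E => dualn eqn.
  (* Boundedness of [w n] makes the penalty finite, so that it cancels. *)
  have Ifin : I \is a fin_num.
    rewrite ge0_fin_numE ?integral_ge0//.
    apply: (@le_lt_trans _ _ (\int[pi]_y (B * (n%:R + 1) + B)%:E)).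
      apply: ge0_le_integral => //.
      - move=> y _; rewrite lee_fin.
        have := gauge_ge0 cPhi (w n y); have := wB y; have := wn n y.
        have : (theta (w n y) * (w n y + 1) <=
            `|theta (w n y)| * (`|w n y| + 1))%R.
          rewrite (le_trans (ler_norm _))// normrM ler_wpM2l//.
          by rewrite (le_trans (ler_normD _ _))// normr1.
        have := normr_ge0 (theta (w n y)); have := normr_ge0 (w n y).
        by nra.
    by rewrite integral_cst_prob ltry.
  rewrite -(@leeD2rE _ I)// -(@leeD2rE _ B%:E)// addeAC -eqn.
  by rewrite leeD2r.
have nd n m y : (n <= m)%N -> (Phi (w n y))%:E <= (Phi (w m y))%:E.
  move=> nm; rewrite lee_fin /w; case: ifPn => [wn1|_]; last first.
    by rewrite (gauge0 cPhi) (gauge_ge0 cPhi).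
  by rewrite (le_trans wn1) ?ler_nat.
have -> : \int[pi]_y (Phi (rho y - 1))%:E =
    \int[pi]_y limn (fun n => (Phi (w n y))%:E).
  apply: eq_integral => y _; apply/esym/lim_near_cst => //.
  near=> n; rewrite /w ifT//.
  near: n; exists (Num.truncn `|rho y - 1|%R).+1 => // n /= ltn.
  by rewrite ltW// (lt_le_trans (truncnS_gt _)) ?ler_nat.
rewrite monotone_convergence//; last 2 first.
- by move=> n y _; rewrite lee_fin (gauge_ge0 cPhi).
- by move=> y _ n m nm; exact: nd.
apply: lime_le; last exact: nearW.
apply: ereal_nondecreasing_is_cvgn => n m nm; apply: ge0_le_integral => //.
- by move=> y _; rewrite lee_fin (gauge_ge0 cPhi).
- by move=> y _; exact: nd.
Unshelve. all: by end_near. Qed.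
End divergence.

(** * Norm bounds as divergence bounds *)

Section norm_gauges.
Set Implicit Arguments.
Unset Strict Implicit.
Context {R : realType}.

Lemma measurable_sgr : measurable_fun [set: R] (@Num.sg R).
Proof.
have -> : @Num.sg R = fun x => if (0 < x)%R then 1%R else
    if (x < 0)%R then (-1)%R else 0%R.
  by apply/funext => x; case: sgrP.
by do 2 (apply: measurable_fun_ifT => //; first exact: measurable_fun_ltr).
Qed.

(** The condition [|u| <= c] almost surely, which expresses a bound on the
    supremum norm, says that the integral of this gauge vanishes. *)
Definition trunc_gauge (c u : R) : R := Num.max 0%R (`|u| - c)%R.
Definition trunc_slope (c w : R) : R := if (c < `|w|)%R then Num.sg w else 0%R.

Lemma trunc_convex_gauge (c : R) : (0 < c)%R ->
  convex_gauge (trunc_gauge c) (trunc_slope c).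
Proof.
move=> c0; split.
- apply: measurable_maxr => //; apply: measurable_funB => //.
- apply: measurable_fun_ifT => //; first exact: measurable_fun_ltr.
  exact: measurable_sgr.
- by move=> u; rewrite le_max lexx.
- by rewrite /trunc_gauge normr0 sub0r; apply/max_idPl; rewrite oppr_le0 ltW.
- by rewrite /trunc_slope sgr0 if_same.
- move=> u w; rewrite /trunc_gauge /trunc_slope; case: ltP => cw; last first.
    rewrite mul0r addr0 (_ : Num.max 0 _ = 0)%R; last first.
      by apply/max_idPl; rewrite subr_le0.
    by rewrite le_max lexx.
  rewrite (_ : Num.max 0 (`|w| - c) = `|w| - c)%R; last first.
    by apply/max_idPr; rewrite subr_ge0 ltW.
  rewrite le_max; apply/orP; right.
  have : (Num.sg w * u <= `|u|)%R.
    rewrite (le_trans (ler_norm _))// normrM ler_piMl// normr_sg.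
    by case: (_ != _).
  by rewrite mulrBr -normrEsg; lra.
- move=> n; exists 1%R => w _; rewrite /trunc_slope; case: ifP => _; last first.
    by rewrite normr0.
  by rewrite normr_sg; case: (_ != _).
Qed.

Definition power_slope (r w : R) : R := (r * Num.sg w * `|w| `^ (r - 1))%R.

(** Young's inequality for the exponents [r] and [r / (r - 1)]; the case
    [r = 1], which has no finite conjugate, is immediate. *)
Lemma power_young (r u w : R) : (1 <= r)%R ->
  (r * (`|u| * `|w| `^ (r - 1)) <= `|u| `^ r + (r - 1) * `|w| `^ r)%R.
Proof.
rewrite le_eqVlt => /predU1P[<-|r1].
  by rewrite subrr powRr0 powRr1// !mul1r mul0r addr0 mulr1.
have r0 : (0 < r)%R by rewrite (lt_trans _ r1).
have s0 : (0 < r - 1)%R by rewrite subr_gt0.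
have := @conjugate_powR R `|u|%R (`|w| `^ (r - 1))%R r (r / (r - 1))%R
  (normr_ge0 _) (powR_ge0 _ _) r0 (divr_gt0 r0 s0).
rewrite -powRrM [((r - 1) * _)%R]mulrC divfK ?gt_eqF//.
rewrite invfM invrK => /(_ _)/(ler_wpM2l (ltW r0)) H.
apply: le_trans (H _) _; first by field; rewrite !gt_eqF.
rewrite le_eqVlt; apply/orP; left; apply/eqP; field.
by rewrite !gt_eqF.
Qed.

Lemma power_convex_gauge (r : R) : (1 <= r)%R ->
  convex_gauge (fun u => `|u| `^ r)%R (power_slope r).
Proof.
move=> r1; have r0 : (0 < r)%R by rewrite (lt_le_trans _ r1).
have mpow s : measurable_fun [set: R] (fun u : R => `|u| `^ s)%R.
  exact: (measurableT_comp (measurable_powR s)).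
split=> [||u|||u w|n].
- exact: mpow.
- by do 2 apply: measurable_funM => //; exact: measurable_sgr.
- exact: powR_ge0.
- by rewrite normr0 powR0// gt_eqF.
- by rewrite /power_slope sgr0 mulr0 mul0r.
- have wE : (power_slope r w * w = r * `|w| `^ r)%R.
    rewrite /power_slope -[in RHS](@mulr_powRB1 _ `|w|%R r)//.
    by rewrite {2}normrEsg; ring.
  have := power_young u w r1.
  have : (power_slope r w * u <= r * (`|u| * `|w| `^ (r - 1)))%R.
    rewrite /power_slope -mulrA -mulrA ler_wpM2l ?(ltW r0)// mulrCA mulrC.
    rewrite ler_wpM2r ?powR_ge0// (le_trans (ler_norm _))// normrM.
    by rewrite ler_piMl// normr_sg; case: (_ != _).
  by rewrite mulrBr wE; lra.
- exists (r * n `^ (r - 1))%R => w wn.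
  rewrite /power_slope !normrM (ger0_norm (ltW r0)) (ger0_norm (powR_ge0 _ _)).
  rewrite -mulrA ler_wpM2l ?(ltW r0)// (@le_trans _ _ (`|w| `^ (r - 1))%R)//.
    by rewrite ler_piMl ?powR_ge0// normr_sg; case: (_ != _).
  rewrite ge0_ler_powR ?nnegrE ?subr_ge0//.
  exact: le_trans wn.
Qed.
End norm_gauges.

Section norm_criterion.
Set Implicit Arguments.
Unset Strict Implicit.
Context {d : measure_display} {T : measurableType d} {R : realType}.
Variable pi : probability T R.

(** The density provided for charges is nonnegative only almost everywhere;
    a nonnegative real-valued version allows integrating all nonnegative
    functions. *)
Lemma density_exists (nu : probability T R) : nu `<< pi ->
  exists rho : T -> R, [/\ measurable_fun [set: T] rho,
    (forall x, 0 <= rho x)%R, is_density pi nu rho &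
    {ae pi, forall x, ('d (charge_of_finite_measure nu) '/d pi) x =
                      (rho x)%:E}].
Proof.
move=> nupi; pose F := Radon_Nikodym_SigmaFinite.f nu pi.
have Ffin x : F x \is a fin_num by exact: Radon_Nikodym_SigmaFinite.f_fin_num.
have F0 x : 0 <= F x by exact: Radon_Nikodym_SigmaFinite.f_ge0.
have mF : measurable_fun [set: T] F.
  exact: measurable_int (Radon_Nikodym_SigmaFinite.f_integrable _).
exists (fine \o F); split.
- exact: measurableT_comp mF.
- by move=> x; exact: fine_ge0.
- move=> f f0 mf.
  rewrite -(Radon_Nikodym_SigmaFinite.change_of_variables nupi)//.
  by apply: eq_integral => x _; rewrite fineK.
- have := ae_eq_Radon_Nikodym_SigmaFinite nupi measurableT.
  by apply: filterS => x /(_ Logic.I) <-; rewrite fineK.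
Qed.

Lemma ae_eq_Lnorm (p : \bar R) (f g : T -> \bar R) :
  measurable_fun [set: T] f -> measurable_fun [set: T] g ->
  {ae pi, forall x, f x = g x} -> Lnorm pi p f = Lnorm pi p g.
Proof.
move=> mf mg fg; rewrite unlock; case: p => [r||].
- congr (_ `^ _); apply: ge0_ae_eq_integral => //.
  + by apply: (measurableT_comp (measurable_poweR _)); exact: measurableT_comp.
  + by apply: (measurableT_comp (measurable_poweR _)); exact: measurableT_comp.
  + by move=> x _; exact: poweR_ge0.
  + by move=> x _; exact: poweR_ge0.
  + by apply: filterS fg => x -> _.
- congr (if _ then _ else _); apply: eq_ess_sup.
  by apply: filterS fg => x /= ->.
- congr (if _ then _ else _); apply: eq_ess_inf.
  by apply: filterS fg => x /= ->.
Qed.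

Lemma Lnorm_gauge (p : \bar R) (c : R) : 1 <= p -> (0 < c)%R ->
  exists Phi theta C, [/\ convex_gauge Phi theta, (0 <= C)%R &
    forall f : T -> R, measurable_fun [set: T] f ->
      (Lnorm pi p (EFin \o f) <= c%:E <-> \int[pi]_x (Phi (f x))%:E <= C%:E)].
Proof.
case: p => [r|_ c0|//].
- rewrite lee_fin => r1 c0; have r0 : (0 < r)%R by rewrite (lt_le_trans _ r1).
  exists (fun u => `|u| `^ r)%R, (power_slope r), (c `^ r)%R; split.
  + exact: power_convex_gauge.
  + exact: powR_ge0.
  + move=> f mf; have -> : \int[pi]_x (`|f x| `^ r)%:E =
        Lnorm pi r%:E (EFin \o f) `^ r by rewrite poweR_Lnorm ?gt_eqF.
    have := Lnorm_ge0 pi r%:E (EFin \o f).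
    case: (Lnorm pi r%:E (EFin \o f)) => [x||//] x0.
      rewrite poweR_EFin !lee_fin; rewrite lee_fin in x0; split=> xc.
        by rewrite ge0_ler_powR ?nnegrE ?(ltW r0) ?(ltW c0).
      rewrite leNgt; apply/negP => cx; move: xc; apply/negP; rewrite -ltNge.
      by rewrite gt0_ltr_powR ?nnegrE ?(ltW c0).
    by rewrite poweRyr ?gt_eqF//; split; rewrite leye_eq.
- exists (trunc_gauge c), (trunc_slope c), 0%R; split.
  + exact: trunc_convex_gauge.
  + exact: lexx.
  + move=> f mf; have g0 x : 0 <= (trunc_gauge c (f x))%:E.
      by rewrite lee_fin (gauge_ge0 (trunc_convex_gauge c0)).
    have mg : measurable_fun [set: T] (fun x => (trunc_gauge c (f x))%:E).
      apply/measurable_EFinP.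
      exact: measurableT_comp (gauge_measurable (trunc_convex_gauge c0)) mf.
    have gE x : (trunc_gauge c (f x))%:E = 0 <-> (`|f x| <= c)%R.
      rewrite /trunc_gauge; split=> [[]|fc].
        by move/max_idPl; rewrite subr_le0.
      by congr (_%:E); apply/max_idPl; rewrite subr_le0.
    rewrite unlock /= probability_setT lte01; split.
      move/ess_supP => fc; rewrite le_eqVlt; apply/orP; left; apply/eqP.
      rewrite -[RHS](integral_cst_prob pi); apply: ae_eq_integral => //.
      by apply: filterS fc => x /= fc _; apply/gE; rewrite -lee_fin.
    move=> g_le0; apply/ess_supP.
    have : \int[pi]_x `|(trunc_gauge c (f x))%:E| = 0.
      under eq_integral do rewrite gee0_abs//.
      by apply/eqP; rewrite eq_le g_le0 integral_ge0.
    move=> /(ae_eq_integral_abs _ measurableT mg).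
    by apply: filterS => x /(_ Logic.I)/gE; rewrite /= lee_fin.
Qed.
End norm_criterion.

(** * Mixing bounds under multiplication by a stationary kernel *)

Section mixing_transfer.
Set Implicit Arguments.
Unset Strict Implicit.
Context {d : measure_display} {T : measurableType d} {R : realType}.
Variables (pi : probability T R) (p : \bar R).
Hypothesis p_ge1 : 1 <= p.
Implicit Types (J K L P : R.-pker T ~> T) (c : R).

(** The condition defining admissible times in [t_mix], for a single kernel. *)
Definition mixed c K : Prop :=
  {ae pi, forall x, K x `<< pi} /\
  {ae pi, forall x, 'N[pi]_p[(fun y =>
    ('d (charge_of_finite_measure (klaw K x)) '/d pi) y - 1)] <= c%:E}.

Lemma mixed_kpow c P t :
  step_ac pi P t /\ mix_dist pi p P t <= c%:E <-> mixed c (kpow P t).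
Proof.
rewrite /mixed /mix_dist -/(step_ac pi P t); split=> -[Pac].
  by rewrite asboolT// => /ess_supP.
by move=> H; split => //; rewrite asboolT//; exact/ess_supP.
Qed.

Lemma le_mixed c c' K : (c <= c')%R -> mixed c K -> mixed c' K.
Proof.
move=> cc' [Kac Kc]; split => //; apply: filterS Kc => x /le_trans; apply.
by rewrite lee_fin.
Qed.

Lemma Lnorm_density (nu : probability T R) rho : nu `<< pi ->
  measurable_fun [set: T] rho ->
  {ae pi, forall x, ('d (charge_of_finite_measure nu) '/d pi) x =
                    (rho x)%:E} ->
  Lnorm pi p (fun y => ('d (charge_of_finite_measure nu) '/d pi) y - 1) =
  Lnorm pi p (EFin \o (fun y => rho y - 1)%R).
Proof.
move=> nupi mrho nurho; apply: ae_eq_Lnorm.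
- exact: emeasurable_funB.
- by apply/measurable_EFinP; exact: measurable_funB.
- by apply: filterS nurho => x ->.
Qed.

Section gauge.
Variables (c : R) (Phi theta : R -> R) (C : R).
Hypothesis cPhi : convex_gauge Phi theta.
Hypothesis normP : forall f : T -> R, measurable_fun [set: T] f ->
  (Lnorm pi p (EFin \o f) <= c%:E <-> \int[pi]_x (Phi (f x))%:E <= C%:E).

Lemma dual_bound_kmulr (nu : probability T R) K
    (nu' : {measure set T -> \bar R}) : nu `<< pi -> stationary pi K ->
  (forall A, measurable A -> nu' A = \int[nu]_y K y A) ->
  Lnorm pi p (fun y => ('d (charge_of_finite_measure nu) '/d pi) y - 1)
    <= c%:E ->
  dual_bound pi Phi theta C nu'.
Proof.
move=> nupi Kpi nu'E; have [rho [mrho rho0 nurho rhoE]] := density_exists nupi.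
rewrite (Lnorm_density nupi mrho rhoE) normP; last exact: measurable_funB.
move=> Nc; exact: (dual_bound_density cPhi nu'E Kpi mrho rho0 nurho Nc).
Qed.

Lemma Lnorm_dual_bound (nu : probability T R) : nu `<< pi ->
  dual_bound pi Phi theta C nu ->
  Lnorm pi p (fun y => ('d (charge_of_finite_measure nu) '/d pi) y - 1) <= c%:E.
Proof.
move=> nupi nudual; have [rho [mrho rho0 nurho rhoE]] := density_exists nupi.
rewrite (Lnorm_density nupi mrho rhoE) normP; last exact: measurable_funB.
exact: (density_bound cPhi mrho rho0 nurho nudual).
Qed.
End gauge.

(** The density of [K J] is the image of the density of [K] under the adjoint
    of [J], an [L^p] contraction by Jensen; duality replaces the adjoint. *)
Lemma mixed_kmulr c K J L : (0 < c)%R -> stationary pi J ->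
  keq L (pkmul K J) -> mixed c K -> mixed c L.
Proof.
move=> c0 Jpi LE [Kac Kc].
have Lac x : K x `<< pi -> L x `<< pi.
  move=> /null_content_dominatesP Kpi; apply/null_content_dominatesP => A mA A0.
  rewrite LE//; have [B [mB B0 JB]] := ae_stationary_null Jpi mA A0.
  have : {ae K x, forall y, J y A = 0} by exists B; split => //; exact: Kpi.
  move=> KJ; rewrite -[RHS](integral_cst_pker K x).
  apply: ae_eq_integral => //; first exact: measurable_kernel.
  by apply: filterS KJ => y.
split; first by apply: filterS Kac => x; exact: Lac.
have [Phi [theta [C [cPhi C0 normP]]]] := Lnorm_gauge pi p_ge1 c0.
apply: filterS2 Kac Kc => x Kx Kxc.
apply: (Lnorm_dual_bound cPhi normP (nu := klaw L x)); first exact: Lac.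
apply: (dual_bound_kmulr cPhi normP (nu := klaw K x) Kx Jpi _ Kxc).
by move=> A mA; rewrite [LHS]LE.
Qed.

(** The laws of [J K] are mixtures of those of [K] by laws for which the
    exceptional [pi]-null set of [K] is almost surely null. *)
Lemma mixed_kmull c J K L : (0 < c)%R -> stationary pi J ->
  keq L (pkmul J K) -> mixed c K -> mixed c L.
Proof.
move=> c0 Jpi LE [Kac Kc].
have Lac : {ae pi, forall x, L x `<< pi}.
  apply: filterS (ae_stationary Jpi Kac) => x JK.
  apply/null_content_dominatesP => A mA A0.
  rewrite LE// -[RHS](integral_cst_pker J x).
  apply: ae_eq_integral => //; first exact: measurable_kernel.
  by apply: filterS JK => y /null_content_dominatesP Ky _; exact: Ky.
split => //.
have [Phi [theta [C [cPhi C0 normP]]]] := Lnorm_gauge pi p_ge1 c0.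
have Kdual : {ae pi, forall y, dual_bound pi Phi theta C (K y)}.
  apply: filterS2 Kac Kc => y Ky Kyc.
  (* Data processing for the identity kernel is the dual bound itself. *)
  apply: (dual_bound_kmulr cPhi normP (nu := klaw K y) Ky
    (stationary1 pi K) _ Kyc).
  by move=> A mA; rewrite [RHS](kmul1 K).
apply: filterS2 Lac (ae_stationary Jpi Kdual) => x Lx JKdual.
apply: (Lnorm_dual_bound cPhi normP (nu := klaw L x)) => //.
apply: (dual_bound_mixture cPhi C0 (mu := klaw J x) (K := K)) => //.
by move=> A mA; rewrite [LHS]LE.
Qed.

Lemma t_mix_le P P' eps eps' (k : nat) :
  (forall t, (0 < t)%N ->
    mixed eps (kpow P t) -> mixed eps' (kpow P' (t + k))) ->
  t_mix pi p P' eps' <= t_mix pi p P eps + k%:R%:E.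
Proof.
move=> PP'; rewrite -leeBlDr//; apply: le_ereal_inf_tmp => _ [t [t0 Pac Pt] <-].
have /mixed_kpow Pmixed := conj Pac Pt.
have /mixed_kpow[P'ac P't] := PP' t t0 Pmixed.
rewrite leeBlDr//; apply: ereal_inf_lbound; exists (t + k)%N.
  by split => //; rewrite addn_gt0 t0.
by rewrite natrD EFinD.
Qed.
End mixing_transfer.

Theorem theorem5p1 (R : realType) (X : ptopologicalType)
    (polishX : polish_space R X)
    (gT : finGroupType) (a : measurable_action gT (borel X))
    (pi : probability (borel X) R)
    (m : {measure set (borel X) -> \bar R})
    (pi_density : has_density pi m) (m_inv : group_invariant a m)
    (P : R.-pker (borel X) ~> (borel X)) (P_stat : stationary pi P)
    (pi_inv : group_invariant a pi)
    (p : \bar R) (p_ge1 : 1 <= p) (eps : R) (eps_gt0 : (0 < eps)%R) :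
  (t_mix pi p (P_ra a (P_la a P)) (2 * eps)%R <= t_mix pi p (P_la a P) eps /\
   t_mix pi p (P_la a P) eps <= t_mix pi p (P_ra a (P_la a P)) (eps / 2)%R + 1)
  /\
  (t_mix pi p (P_ra a (P_la a P)) (2 * eps)%R <= t_mix pi p (P_ra a P) eps /\
   t_mix pi p (P_ra a P) eps <= t_mix pi p (P_ra a (P_la a P)) (eps / 2)%R + 1).
Proof.
pose Q := orbit_kernel a (R := R); pose W := P_ra a (P_la a P).
pose L := P_la a P; pose S := P_ra a P.
have QQ : keq (pkmul Q Q) Q := orbit_kernel_idem a.
have LE : keq L (pkmul Q P) := keq_P_la a P.
have SE : keq S (pkmul P Q) := keq_P_ra a P.
have WL : keq W (pkmul L Q) := keq_P_ra a L.
have QL : keq (pkmul Q L) L.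
  apply: (keq_trans (L := pkmul Q (pkmul Q P))); first exact: keq_kmul.
  apply: (keq_trans (kmulA _ _ _)); apply: keq_trans (keq_sym LE).
  exact: keq_kmul.
have SQ : keq (pkmul S Q) S.
  apply: (keq_trans (L := pkmul (pkmul P Q) Q)); first exact: keq_kmul.
  apply: (keq_trans (keq_sym (kmulA _ _ _))); apply: keq_trans (keq_sym SE).
  exact: keq_kmul.
have WS : keq W (pkmul Q S).
  apply: keq_trans WL _; apply: (keq_trans (L := pkmul (pkmul Q P) Q)).
    exact: keq_kmul.
  apply: (keq_trans (keq_sym (kmulA _ _ _))); apply: keq_kmul => //.
  exact: keq_sym.
have Qpi : stationary pi Q := orbit_kernel_stationary pi_inv.
have Lpi : stationary pi L.
  by move=> A mA; under eq_integral do rewrite LE//; exact: stationary_kmul.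
have eps_le : (eps <= 2 * eps)%R by lra.
have eps2 : (0 < eps / 2)%R by lra.
have eps2_le : (eps / 2 <= eps)%R by lra.
split; split.
- rewrite -[leRHS]adde0; apply: (t_mix_le (k := 0)) => -[//|t] _ Lt.
  rewrite addn0; apply: le_mixed eps_le _.
  exact: mixed_kmulr (kpow_kmulr t WL QL) Lt.
- apply: (t_mix_le (k := 1)) => t _ Wt.
  rewrite addn1; apply: le_mixed eps2_le _.
  exact: mixed_kmulr (kpowS_kmulr t WL QL) Wt.
- rewrite -[leRHS]adde0; apply: (t_mix_le (k := 0)) => -[//|t] _ St.
  rewrite addn0; apply: le_mixed eps_le _.
  exact: mixed_kmull (kpow_kmull t WS SQ) St.
- apply: (t_mix_le (k := 1)) => -[//|t] _ Wt.
  rewrite addn1; apply: le_mixed eps2_le _.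
  exact: mixed_kmull (kpowS_kmull t WS SE SQ) Wt.
Qed.
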